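(* Let $CHV$ be the free $\mathbb{C}[\partial]$-module with $\mathbb{C}[\partial]$-basis $\{L_i,H_i\mid i\in\mathbb{Z}\}$. Then $CHV$ is a Lie conformal algebra with $\lambda$-brackets defined by $$[L_i\,{}_\lambda\,L_j]=(\partial+2\lambda)L_{i+j},\quad[L_i\,{}_\lambda\,H_j]=(\partial+\lambda)H_{i+j},\quad[H_i\,{}_\lambda\,L_j]=\lambda H_{i+j},\quad[H_i\,{}_\lambda\,H_j]=0\qquad(i,j\in\mathbb{Z}).$$
   Context: A Lie conformal algebra is a $\mathbb{C}[\partial]$-module $A$ with a linear map $A\otimes A\to A[\lambda]=\mathbb{C}[\lambda]\otimes A$, $a\otimes b\mapsto[a\,{}_\lambda\,b]$ (the $\lambda$-bracket), satisfying for all $a,b,c\in A$: $[\partial a\,{}_\lambda\,b]=-\lambda[a\,{}_\lambda\,b]$ and $[a\,{}_\lambda\,\partial b]=(\partial+\lambda)[a\,{}_\lambda\,b]$; $[a\,{}_\lambda\,b]=-[b\,{}_{-\lambda-\partial}\,a]$; $[a\,{}_\lambda\,[b\,{}_\mu\,c]]=[[a\,{}_\lambda\,b]\,{}_{\lambda+\mu}\,c]+[b\,{}_\mu\,[a\,{}_\lambda\,c]]$. $\lambda$-brackets given on a $\mathbb{C}[\partial]$-basis are extended to the whole module by the first two identities. *)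

(* Defs.v *)
From HB Require Import structures.
From mathcomp Require Import all_boot all_order all_algebra.
From mathcomp Require Import finmap monalg reals complex.

Set Implicit Arguments.
Unset Strict Implicit.
Unset Printing Implicit Defensive.

Import GRing.Theory.
Local Open Scope ring_scope.

(* polymod M is M[t] = k[t] (x)_k M, for a module M over a commutative ring k:
   finitely supported families of coefficients u@_n in M, u standing for
   \sum_n t^n u@_n. It is a module over k[t] = {poly k}, with k acting
   coefficientwise and 'X raising every exponent by one. *)
Definition polymod (k : comNzRingType) (M : lmodType k) := {malg M[nat]}.

HB.instance Definition _ (k : comNzRingType) (M : lmodType k) :=
  GRing.Zmodule.on (polymod M).

Section PolyModule.
Variables (k : comNzRingType) (M : lmodType k).
Implicit Types (p q : {poly k}) (u v : polymod M).

Definition polymod_const (a : M) : polymod M := << a *g 0%N >>.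

Definition polymod_scale p u : polymod M :=
  \sum_(i < size p) \sum_(n <- msupp u) << p`_i *: u@_n *g (i + n)%N >>.

Lemma polymod_scaleE p u m :
  (polymod_scale p u)@_m = \sum_(i < m.+1) p`_i *: u@_(m - i)%N.
Proof.
rewrite /polymod_scale raddf_sum /=.
have inner (i : nat) :
    mcoeff m (\sum_(n <- msupp u) << p`_i *: u@_n *g (i + n)%N >>)
    = if (i < m.+1)%N then p`_i *: u@_(m - i)%N else 0.
  rewrite raddf_sum /=; case: ifP => [le_im|gt_im].
    have [mi_u|mi_u] := boolP ((m - i)%N \in msupp u).
      rewrite (big_fsetD1 _ mi_u) /= mcoeffU subnKC // eqxx mulr1n.
      rewrite big1_fset ?addr0 // => n.
      rewrite in_fsetD1 => /andP[ne_n _] _; rewrite mcoeffU.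
      have [e|//] := eqVneq (i + n)%N m.
      by rewrite -e addKn eqxx in ne_n.
    rewrite (mcoeff_outdom mi_u) scaler0 big1_fset // => n n_u _.
    rewrite mcoeffU; have [e|//] := eqVneq (i + n)%N m.
    by rewrite -e addKn n_u in mi_u.
  rewrite big1_fset // => n _ _; rewrite mcoeffU.
  have [e|//] := eqVneq (i + n)%N m.
  by rewrite -e ltnS leq_addr in gt_im.
under eq_bigr do rewrite inner.
pose F i := if (i < m.+1)%N then p`_i *: u@_(m - i)%N else 0.
have -> : \sum_(i < m.+1) p`_i *: u@_(m - i)%N = \sum_(i < m.+1) F i.
  by apply: eq_bigr => i _; rewrite /F ltn_ord.
rewrite -[LHS](big_mkord predT F) -[RHS](big_mkord predT F).
have ext a : (a <= size p + m.+1)%N ->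
    (forall i, (a <= i)%N -> F i = 0) ->
    \sum_(0 <= i < a) F i = \sum_(0 <= i < size p + m.+1) F i.
  move=> le_a F0; rewrite [RHS](big_cat_nat _ le_a) //=.
  rewrite [X in _ = _ + X]big_nat_cond.
  by rewrite [X in _ = _ + X]big1 ?addr0 // => i /andP[/andP[/F0->]].
rewrite !ext ?leq_addr ?leq_addl // /F => i hi.
  by rewrite ltnNge hi.
by rewrite nth_default // scale0r if_same.
Qed.

Fact polymod_scaleA p q u :
  polymod_scale p (polymod_scale q u) = polymod_scale (p * q) u.
Proof.
apply/malgP => m; rewrite !polymod_scaleE.
under eq_bigr do rewrite polymod_scaleE scaler_sumr.
under [RHS]eq_bigr do rewrite coefM scaler_suml.
pose G i j := (p`_i * q`_j) *: u@_(m - (i + j))%N.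
transitivity (\sum_(i < m.+1) \sum_(j < m.+1 | (i + j < m.+1)%N) G i j).
  apply: eq_bigr => i _.
  rewrite (big_ord_widen_cond m.+1 predT
    (fun j => p`_i *: (q`_j *: u@_(m - i - j)%N))) ?ltnS ?leq_subr //.
  by apply: eq_big => [j|j _] /=;
    rewrite ?scalerA /G ?subnDA // !ltnS leq_subRL // -ltnS.
under [RHS]eq_bigr => l _.
  rewrite (big_ord_widen m.+1
    (fun i => (p`_i * q`_(l - i)%N) *: u@_(m - l)%N) (ltn_ord l)).
  over.
rewrite [RHS](exchange_big_dep predT) //=; apply: eq_bigr => i _.
rewrite -(big_mkord (fun j => (i + j < m.+1)%N) (G i)).
rewrite -(big_mkord (fun l => (i < l.+1)%N)
  (fun l => (p`_i * q`_(l - i)%N) *: u@_(m - l)%N)).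
have le_i : (i <= m.+1)%N by rewrite ltnW.
rewrite [RHS](big_cat_nat _ le_i) //= [X in _ = X + _]big_nat_cond.
rewrite [X in _ = X + _]big1 ?add0r; last first.
  by move=> l /andP[/andP[_ lt_l]]; rewrite ltnS leqNgt lt_l.
rewrite [LHS](big_cat_nat (n := m.+1 - i)) ?leq_subr //=.
rewrite [X in _ + X = _]big_nat_cond [X in _ + X = _]big1 ?addr0; last first.
  by move=> l /andP[/andP[ge_l _]]; rewrite ltnNge -leq_subLR ge_l.
rewrite [RHS](big_addn 0 m.+1 i).
rewrite big_nat_cond [RHS]big_nat_cond; apply: eq_big => [j|j _].
  by rewrite [(i < _)%N]leq_addl andbT -ltn_subRL andbb.
by rewrite /G addnK [(j + i)%N]addnC.
Qed.

Fact polymod_scale1 : left_id 1 polymod_scale.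
Proof.
move=> u; apply/malgP => m; rewrite polymod_scaleE big_ord_recl /= big1.
  by rewrite coef1 scale1r addr0 subn0.
by move=> i _; rewrite coef1 scale0r.
Qed.

Fact polymod_scaleDr : right_distributive polymod_scale +%R.
Proof.
move=> p u v; apply/malgP => m; rewrite mcoeffD !polymod_scaleE -big_split.
by apply: eq_bigr => i _; rewrite mcoeffD scalerDr.
Qed.

Fact polymod_scaleDl u : {morph polymod_scale^~ u : p q / p + q}.
Proof.
move=> p q; apply/malgP => m; rewrite mcoeffD !polymod_scaleE -big_split.
by apply: eq_bigr => i _; rewrite coefD scalerDl.
Qed.

HB.instance Definition _ := GRing.Zmodule_isLmodule.Build {poly k} (polymod M)
  polymod_scaleA polymod_scale1 polymod_scaleDr polymod_scaleDl.

End PolyModule.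

(* Substitution: \sum_n t^n u_n |-> \sum_n x^n f(u_n), in a module N over a
   ring containing x. *)
Definition polymod_subst (k : comNzRingType) (M : lmodType k)
    (S : comNzRingType) (N : lmodType S) (f : M -> N) (x : S)
    (u : polymod M) : N :=
  \sum_(n <- msupp u) x ^+ n *: f u@_n.

(* k[d]-modules are lmodType's over {poly k}, with d = 'X. For such an A,
   A[lambda] = k[lambda] (x)_k A = k[d][lambda] (x)_k[d] A is polymod A, a module
   over k[d][lambda] = {poly {poly k}}, where d = 'X%:P and lambda = 'X, and
   A[lambda, mu] = A[lambda][mu] is a module over k[d][lambda][mu], where
   d = 'X%:P%:P, lambda = 'X%:P and mu = 'X. *)
Section LieConformal.
Variables (k : comNzRingType) (A : lmodType {poly k}).

Local Notation d1 := ('X%:P : {poly {poly k}}).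
Local Notation lambda1 := ('X : {poly {poly k}}).
Local Notation lambda2 := ('X%:P : {poly {poly {poly k}}}).
Local Notation mu2 := ('X : {poly {poly {poly k}}}).

Definition polymod_const2 (a : A) : polymod (polymod A) :=
  polymod_const (polymod_const a).

Record is_lie_conformal (br : A -> A -> polymod A) : Prop := {
  lc_linearl : forall (c : k) (a a' b : A),
    br (c%:P *: a + a') b = c%:P%:P *: br a b + br a' b;
  lc_linearr : forall (c : k) (a b b' : A),
    br a (c%:P *: b + b') = c%:P%:P *: br a b + br a b';
  lc_sesquil : forall a b : A, br ('X *: a) b = - lambda1 *: br a b;
  lc_sesquir : forall a b : A, br a ('X *: b) = (d1 + lambda1) *: br a b;
  lc_skew : forall a b : A,
    br a b = - polymod_subst (@polymod_const _ A) (- lambda1 - d1) (br b a);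
  lc_jacobi : forall a b c : A,
    polymod_subst (fun w => polymod_subst polymod_const2 lambda2 (br a w)) mu2 (br b c)
    = polymod_subst (fun w => polymod_subst polymod_const2 (lambda2 + mu2) (br w c))
        lambda2 (br a b)
    + polymod_subst (fun w => polymod_subst polymod_const2 mu2 (br b w))
        lambda2 (br a c)
}.

End LieConformal.

(* Extension of a lambda-bracket b0 given on the basis I of the free k[d]-module
   {malg {poly k}[I]}: [f(d)x _lambda g(d)y] = f(-lambda) g(d + lambda) b0 x y.
   Here f^:P is f(lambda) in k[d][lambda]. *)
Definition sesqui_ext (k : comNzRingType) (I : choiceType)
    (b0 : I -> I -> polymod {malg {poly k}[I]}) (u v : {malg {poly k}[I]}) :
    polymod {malg {poly k}[I]} :=
  \sum_(x <- msupp u) \sum_(y <- msupp v)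
    (((u@_x)^:P \Po - 'X) * ((v@_y)^:P \Po ('X%:P + 'X))) *: b0 x y.

Section CHV.
Variable k : comNzRingType.

(* The index inl i stands for L_i and inr i for H_i. *)
Definition CHV : lmodType {poly k} := {malg {poly k}[(int + int)%type]}.

Definition chvL (i : int) : CHV := << inl i >>.
Definition chvH (i : int) : CHV := << inr i >>.

Definition chv_basis_bracket (x y : (int + int)%type) : polymod CHV :=
  match x, y with
  | inl i, inl j => ('X%:P + 2 * 'X) *: polymod_const (chvL (i + j))
  | inl i, inr j => ('X%:P + 'X) *: polymod_const (chvH (i + j))
  | inr i, inl j => 'X *: polymod_const (chvH (i + j))
  | inr i, inr j => 0
  end.

Definition chv_bracket : CHV -> CHV -> polymod CHV :=
  sesqui_ext chv_basis_bracket.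

End CHV.

(* Main.v *)
(* By sesquilinearity, each side of skew-symmetry and of the Jacobi identity is
   semilinear in each of its arguments: replacing an argument a by p(d) a
   multiplies it by p(x), where x is - lambda, d + lambda for the two arguments
   of skew-symmetry and - lambda, - mu, d + lambda + mu for the three arguments
   of Jacobi. Both identities thus need to be checked on the basis only. There
   every iterated bracket is a multiple of a single L_n or H_n, n being the sum
   of the indices, and the identities become polynomial identities in d, lambda
   and mu. *)
Require Import Defs.
From HB Require Import structures.
From mathcomp Require Import all_boot all_order all_algebra.
From mathcomp Require Import finmap monalg reals complex.
From mathcomp Require Import ring.

Set Implicit Arguments.
Unset Strict Implicit.
Unset Printing Implicit Defensive.

Import GRing.Theory.
Local Open Scope ring_scope.
Local Open Scope complex_scope.

(** * Sums over supports, and induction on finitely supported families *)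

Section MalgSum.
Variables (K : choiceType) (G N : zmodType) (F : K -> G -> N).
Hypothesis FD : forall x, {morph F x : a b / a + b}.

Let F0 x : F x 0 = 0.
Proof. by apply: (addrI (F x 0)); rewrite -FD !addr0. Qed.

(** By additivity, terms outside the support vanish; two families can thus be summed over a common
    finite set. *)
Lemma msupp_sumEw (D : {fset K}) (u : {malg G[K]}) :
  (msupp u `<=` D)%fset ->
  \sum_(x <- msupp u) F x u@_x = \sum_(x <- D) F x u@_x.
Proof.
by move=> le; apply: big_fset_incl => // x _ /mcoeff_outdom ->.
Qed.

Lemma msupp_sumD :
  {morph (fun u : {malg G[K]} => \sum_(x <- msupp u) F x u@_x) : u v / u + v}.
Proof.
move=> u v /=.
rewrite (msupp_sumEw (msuppD_le u v)) (msupp_sumEw (fsubsetUl _ (msupp v))).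
rewrite (msupp_sumEw (fsubsetUr (msupp u) _)) -big_split /=.
by apply: eq_bigr => x _; rewrite mcoeffD FD.
Qed.

Lemma msupp_sumU x a : \sum_(y <- msupp << a *g x >>) F y << a *g x >>@_y = F x a.
Proof. by rewrite (msupp_sumEw msuppU_le) big_seq_fset1 mcoeffUU. Qed.

End MalgSum.

Lemma malg_ind (K : choiceType) (G : zmodType) (P : {malg G[K]} -> Prop) :
  P 0 -> (forall u v, P u -> P v -> P (u + v)) ->
  (forall x a, P << a *g x >>) -> forall u, P u.
Proof.
by move=> P0 PD PU u; rewrite [u]monalgE; elim/big_ind: _ => // x _; apply: PU.
Qed.

Lemma malgU_scale (K : choiceType) (R : nzRingType) (a : R) (x : K) :
  << a *g x >> = a *: << x >> :> {malg R[K]}.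
Proof. by apply/malgP => y; rewrite mcoeffZ !mcoeffU mulrnAr mulr1. Qed.

(** * Maps semilinear along a ring map *)

Definition semilinear (R S : nzRingType) (M : lmodType R) (N : lmodType S)
    (phi : R -> S) (f : M -> N) :=
  forall p u v, f (p *: u + v) = phi p *: f u + f v.

Section Semilinear.
Variables (R S : nzRingType) (M : lmodType R) (N : lmodType S).
Variables (phi : {rmorphism R -> S}) (f : M -> N).
Hypothesis f_lin : semilinear phi f.

Lemma semilinearD : {morph f : u v / u + v}.
Proof. by move=> u v; have := f_lin 1 u v; rewrite rmorph1 !scale1r. Qed.

Lemma semilinear0 : f 0 = 0.
Proof. by apply: (addrI (f 0)); rewrite -semilinearD !addr0. Qed.

Lemma semilinearZ p u : f (p *: u) = phi p *: f u.
Proof. by have := f_lin p u 0; rewrite !addr0 semilinear0 addr0. Qed.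

End Semilinear.

Lemma eq_semilinear (R S : nzRingType) (M : lmodType R) (N : lmodType S)
    (phi psi : R -> S) (f : M -> N) :
  phi =1 psi -> semilinear phi f -> semilinear psi f.
Proof. by move=> e fl p u v; rewrite fl e. Qed.

Lemma semilinear_comp (R S T : nzRingType) (M : lmodType R) (N : lmodType S)
    (Q : lmodType T) (phi : R -> S) (psi : {rmorphism S -> T})
    (f : M -> N) (g : N -> Q) :
  semilinear phi f -> semilinear psi g -> semilinear (psi \o phi) (g \o f).
Proof. by move=> fl gl p u v; rewrite /= fl gl. Qed.

Lemma semilinear_add (R S : nzRingType) (M : lmodType R) (N : lmodType S)
    (phi : R -> S) (f g : M -> N) :
  semilinear phi f -> semilinear phi g -> semilinear phi (fun u => f u + g u).
Proof. by move=> fl gl p u v; rewrite fl gl scalerDr addrACA. Qed.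

Lemma semilinear_opp (R S : nzRingType) (M : lmodType R) (N : lmodType S)
    (phi : R -> S) (f : M -> N) :
  semilinear phi f -> semilinear phi (fun u => - f u).
Proof. by move=> fl p u v; rewrite fl scalerN opprD. Qed.

Lemma semilinear_eq_basis (R S : nzRingType) (K : choiceType) (N : lmodType S)
    (phi : {rmorphism R -> S}) (f g : {malg R[K]} -> N) :
  semilinear phi f -> semilinear phi g ->
  (forall x, f << x >> = g << x >>) -> f =1 g.
Proof.
move=> fl gl e; apply: malg_ind => [|u v eu ev|x a].
- by rewrite (semilinear0 fl) (semilinear0 gl).
- by rewrite (semilinearD fl) (semilinearD gl) eu ev.
- by rewrite malgU_scale (semilinearZ fl) (semilinearZ gl) e.
Qed.

(** * Substitution of a scalar for the variable of M[t] *)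

Section PolymodSubst.
Variables (k : comNzRingType) (M : lmodType k).
Variables (S : comNzRingType) (N : lmodType S).

Lemma polymod_const_semilinear : semilinear polyC (@polymod_const k M).
Proof.
move=> c a b; apply/malgP => m; rewrite mcoeffD polymod_scaleE !mcoeffU.
rewrite big_ord_recl big1 ?addr0 => [|i _]; last by rewrite coefC scale0r.
by rewrite coefC /= subn0 mcoeffU; case: eqP; rewrite ?scaler0 ?addr0.
Qed.

(** In the coefficient of exponent [l] only the convolution term of index [n] survives, and it
    exists exactly when [n <= l]. *)
Lemma polymod_scaleXU c n m (a : M) :
  (c *: 'X^n) *: (<< a *g m >> : polymod M) = << c *: a *g (n + m)%N >>.
Proof.
apply/malgP => l; rewrite polymod_scaleE mcoeffU.
transitivity (\sum_(i < l.+1 | i == n :> nat) c *: << a *g m >>@_(l - i)%N).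
  rewrite [RHS]big_mkcond; apply: eq_bigr => i _; rewrite coefZ coefXn.
  by case: eqP => _; rewrite ?mulr1 ?mulr0 ?scale0r.
case: (ltnP n l.+1) => [lt_nl|lt_ln].
  rewrite (big_pred1 (Ordinal lt_nl)) // mcoeffU /=.
  have -> : (m == l - n)%N = (n + m == l)%N.
    by rewrite -(eqn_add2l n m) subnKC.
  by case: eqP; rewrite ?scaler0.
rewrite big_pred0 => [|i].
  by case: eqP => // e; rewrite -e ltnNge leq_addr in lt_ln.
by apply/negbTE; rewrite neq_ltn (leq_trans (ltn_ord i)).
Qed.

Variables (phi : {rmorphism k -> S}) (f : M -> N) (x : S).
Hypothesis f_lin : semilinear phi f.

Let subst_addl n : {morph (fun a : M => x ^+ n *: f a) : a b / a + b}.
Proof. by move=> a b; rewrite /= (semilinearD f_lin) scalerDr. Qed.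

Lemma polymod_substU n a : polymod_subst f x << a *g n >> = x ^+ n *: f a.
Proof. exact: (msupp_sumU subst_addl). Qed.

Lemma polymod_subst_const a : polymod_subst f x (polymod_const a) = f a.
Proof. by rewrite polymod_substU scale1r. Qed.

Lemma polymod_substD : {morph polymod_subst f x : u v / u + v}.
Proof. exact: (msupp_sumD subst_addl). Qed.

(** Both sides are additive in [u] and in [p], so monomials suffice; there it is
    [x ^+ (i + n) = x ^+ i * x ^+ n] and the semilinearity of [f]. *)
Lemma polymod_subst_semilinear :
  semilinear (horner_eval x \o map_poly phi) (polymod_subst f x).
Proof.
move=> p u v; rewrite polymod_substD; congr (_ + _).
have s0 : polymod_subst f x 0 = 0.
  by apply: (addrI (polymod_subst f x 0)); rewrite -polymod_substD !addr0.
elim/malg_ind: u => [|u u' eu eu'|n a].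
- by rewrite scaler0 s0 scaler0.
- by rewrite scalerDr !polymod_substD eu eu' scalerDr.
rewrite -[p]coefK poly_def; elim/big_ind: _ => [|q r eq er|i _].
- by rewrite scale0r s0 rmorph0 scale0r.
- by rewrite scalerDl polymod_substD eq er rmorphD scalerDl.
rewrite polymod_scaleXU !polymod_substU (semilinearZ f_lin) /= /horner_eval.
by rewrite map_polyZ map_polyXn hornerZ hornerXn !scalerA -mulrA exprD [in LHS]mulrC.
Qed.

End PolymodSubst.

(** For an argument that enters through the coefficient map and not through [u]: the scalar [phi p]
    commutes with powers of [x]. *)
Lemma polymod_subst_param (k R : comNzRingType) (M : lmodType k) (B : lmodType R)
    (S : comNzRingType) (N : lmodType S) (phi : R -> S) (f : B -> M -> N)
    (x : S) (u : polymod M) :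
  (forall w, semilinear phi (f^~ w)) ->
  semilinear phi (fun b => polymod_subst (f b) x u).
Proof.
move=> fl p b b'; rewrite /polymod_subst scaler_sumr -big_split /=.
by apply: eq_bigr => n _; rewrite fl scalerDr !scalerA mulrC.
Qed.

(** * Evaluation morphisms on polynomial rings *)

Section PolyEval.
Variables (k S : comNzRingType) (iota : {rmorphism k -> S}).

Definition poly_eval (x : S) : {poly k} -> S :=
  horner_eval x \o map_poly iota.

HB.instance Definition _ x := GRing.RMorphism.on (poly_eval x).

Lemma poly_evalC x c : poly_eval x c%:P = iota c.
Proof. by rewrite /poly_eval /= /horner_eval map_polyC hornerC. Qed.

Lemma poly_evalX x : poly_eval x 'X = x.
Proof. by rewrite /poly_eval /= /horner_eval map_polyX hornerX. Qed.

(** The universal property of k[X]; composites of evaluations are identified through it. *)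
Lemma poly_eval_unique (phi : {rmorphism {poly k} -> S}) x :
  (forall c, phi c%:P = iota c) -> phi 'X = x -> phi =1 poly_eval x.
Proof.
move=> phiC phiX; elim/poly_ind => [|p c eq_p]; first by rewrite !rmorph0.
by rewrite !(rmorphD, rmorphM) /= eq_p phiC phiX poly_evalC poly_evalX.
Qed.

End PolyEval.

Lemma polymod_const_comp_eval (k S : comNzRingType) (iota : {rmorphism k -> S})
    (B : lmodType {poly k}) (M : lmodType S) x
    (f : B -> M) :
  semilinear (poly_eval iota x) f ->
  semilinear (@poly_eval k {poly S} (polyC \o iota) x%:P) (@polymod_const S M \o f).
Proof.
move=> fl; apply: eq_semilinear (semilinear_comp fl (@polymod_const_semilinear S M)).
by apply: poly_eval_unique => [c|] /=; rewrite ?poly_evalC ?poly_evalX.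
Qed.

Section PolyTower.
Variable k : comNzRingType.

Definition polyC2 : k -> {poly {poly k}} := polyC \o polyC.
HB.instance Definition _ := GRing.RMorphism.on polyC2.

Definition polyC3 : k -> {poly {poly {poly k}}} := polyC \o polyC2.
HB.instance Definition _ := GRing.RMorphism.on polyC3.

End PolyTower.

(** These send p(d) to p(x), for x in k[d][lambda] or k[d][lambda][mu]. *)
Notation poly_eval2 k := (@poly_eval k {poly {poly k}} (@polyC2 k)).
Notation poly_eval3 k := (@poly_eval k {poly {poly {poly k}}} (@polyC3 k)).

Section SubstEval.
Variables (k : comNzRingType) (A : lmodType {poly k}).

Lemma polymod_const_eval :
  semilinear (poly_eval2 k 'X%:P) (@polymod_const {poly k} A).
Proof.
apply: eq_semilinear (@polymod_const_semilinear _ A).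
exact: poly_eval_unique.
Qed.

Lemma polymod_const2_eval :
  semilinear (poly_eval3 k 'X%:P%:P) (@polymod_const2 k A).
Proof.
exact: (polymod_const_comp_eval polymod_const_eval).
Qed.

(** A factor p(d) leaves [g] as p(q). As [f] takes d to [z] and lambda becomes [y], the polynomial
    q(d, lambda) turns into q(z, y) = [x]. *)
Lemma polymod_subst_comp_eval (S : comNzRingType) (N : lmodType S)
    (iota : {rmorphism k -> S}) (B : lmodType {poly k})
    (f : A -> N) (g : B -> polymod A) (q : {poly {poly k}}) (x y z : S) :
  semilinear (poly_eval iota z) f -> semilinear (poly_eval2 k q) g ->
  (map_poly (poly_eval iota z) q).[y] = x ->
  semilinear (poly_eval iota x) (polymod_subst f y \o g).
Proof.
move=> fl gl e.
apply: eq_semilinear (semilinear_comp gl (polymod_subst_semilinear y fl)).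
apply: (poly_eval_unique (phi := (horner_eval y \o map_poly (poly_eval iota z))
  \o poly_eval2 k q)) => [c|] /=.
  by rewrite poly_evalC /horner_eval /= map_polyC /= hornerC poly_evalC.
by rewrite poly_evalX.
Qed.

Lemma polymod_subst_scale_const (S : comNzRingType) (N : lmodType S)
    (iota : {rmorphism k -> S}) (f : A -> N) (p : {poly {poly k}}) y z a :
  semilinear (poly_eval iota z) f ->
  polymod_subst f y (p *: polymod_const a)
  = (map_poly (poly_eval iota z) p).[y] *: f a.
Proof.
move=> fl; rewrite (semilinearZ (polymod_subst_semilinear y fl)).
by rewrite (polymod_subst_const _ fl).
Qed.

End SubstEval.

(** * Sesquilinearity of the bracket extended from a basis *)

Section SesquiExt.
Variables (k : comNzRingType) (I : choiceType).
Let A : lmodType {poly k} := {malg {poly k}[I]}.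
Variable b0 : I -> I -> polymod A.

Let left_coef : {poly k} -> {poly {poly k}} := fun p => p^:P \Po - 'X.
Let right_coef : {poly k} -> {poly {poly k}} := fun p => p^:P \Po ('X%:P + 'X).

Let left_coefD : {morph left_coef : p q / p + q}.
Proof. by move=> p q; rewrite /left_coef !rmorphD. Qed.

Let right_coefD : {morph right_coef : p q / p + q}.
Proof. by move=> p q; rewrite /right_coef !rmorphD. Qed.

Let left_coefM p q :
  left_coef (p * q) = poly_eval2 k (- 'X) p * left_coef q.
Proof.
by rewrite /left_coef !rmorphM /poly_eval /= /horner_eval map_poly_comp.
Qed.

Let right_coefM p q :
  right_coef (p * q) = poly_eval2 k ('X%:P + 'X) p * right_coef q.
Proof.
by rewrite /right_coef !rmorphM /poly_eval /= /horner_eval map_poly_comp.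
Qed.

(** The outer summand of [sesqui_ext] as a function of the coefficient at [x], so that the lemmas on
    sums over supports apply. *)
Let F v x p := \sum_(y <- msupp v) (left_coef p * right_coef v@_y) *: b0 x y.

Let F_addl v x : {morph F v x : p q / p + q}.
Proof.
move=> p q; rewrite /F -big_split; apply: eq_bigr => y _.
by rewrite left_coefD mulrDl scalerDl.
Qed.

Let F_addr x p y : {morph (fun q => (left_coef p * right_coef q) *: b0 x y)
  : q r / q + r}.
Proof. by move=> q r; rewrite right_coefD mulrDr scalerDl. Qed.

Lemma sesqui_extU x y : sesqui_ext b0 << x >> << y >> = b0 x y.
Proof.
rewrite [LHS](msupp_sumU (F_addl << y >>)) [LHS](msupp_sumU (F_addr x 1)).
by rewrite /left_coef /right_coef !rmorph1 mulr1 scale1r.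
Qed.

Lemma sesqui_extDl v : {morph (sesqui_ext b0)^~ v : u u' / u + u'}.
Proof. exact: (msupp_sumD (F_addl v)). Qed.

Lemma sesqui_extDr u : {morph sesqui_ext b0 u : v v' / v + v'}.
Proof.
move=> v v'; rewrite /sesqui_ext -big_split; apply: eq_bigr => x _ /=.
exact: (msupp_sumD (F_addr x u@_x)).
Qed.

Lemma sesqui_ext_semilinearl (v : A) :
  @semilinear {poly k} {poly {poly k}} A (polymod A)
    (poly_eval2 k (- 'X)) ((sesqui_ext b0)^~ v).
Proof.
move=> p u u'; rewrite sesqui_extDl; congr (_ + _).
rewrite [LHS](msupp_sumEw (F_addl v) (msuppZ_le p u)) [RHS]scaler_sumr.
apply: eq_bigr => x _; rewrite mcoeffZ scaler_sumr.
by apply: eq_bigr => y _; rewrite scalerA mulrA left_coefM.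
Qed.

Lemma sesqui_ext_semilinearr (u : A) :
  @semilinear {poly k} {poly {poly k}} A (polymod A)
    (poly_eval2 k ('X%:P + 'X)) (sesqui_ext b0 u).
Proof.
move=> p v v'; rewrite sesqui_extDr; congr (_ + _).
rewrite [RHS]scaler_sumr; apply: eq_bigr => x _.
rewrite [LHS](msupp_sumEw (F_addr x u@_x) (msuppZ_le p v)) [RHS]scaler_sumr.
by apply: eq_bigr => y _; rewrite mcoeffZ scalerA right_coefM mulrCA.
Qed.
End SesquiExt.

(** * The action of d in nested brackets *)

Section SesquilinearBracket.
Variables (k : comNzRingType) (A : lmodType {poly k}).
Variable br : A -> A -> polymod A.
Hypothesis brl : forall b, semilinear (poly_eval2 k (- 'X)) (br^~ b).
Hypothesis brr : forall a, semilinear (poly_eval2 k ('X%:P + 'X)) (br a).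

Implicit Types (x y : {poly {poly {poly k}}}).

Lemma bracket_substl x c :
  semilinear (poly_eval3 k (- x))
    (fun w => polymod_subst (@polymod_const2 k A) x (br w c)).
Proof.
apply: (polymod_subst_comp_eval (@polymod_const2_eval k A) (brl c)).
by rewrite rmorphN /= map_polyX hornerN hornerX.
Qed.

Lemma bracket_substr x a :
  semilinear (poly_eval3 k ('X%:P%:P + x))
    (fun w => polymod_subst (@polymod_const2 k A) x (br a w)).
Proof.
apply: (polymod_subst_comp_eval (@polymod_const2_eval k A) (brr a)).
by rewrite rmorphD /= map_polyC map_polyX hornerD hornerC hornerX /= poly_evalX.
Qed.

(** The left slot turns d into minus the bracket variable, which is free of d; hence [x] is absent
    from the result. *)
Lemma bracket_subst_compl (f : A -> polymod (polymod A)) x y c :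
  semilinear (poly_eval3 k x) f ->
  semilinear (poly_eval3 k (- y)) (fun w => polymod_subst f y (br w c)).
Proof.
move=> fl; apply: (polymod_subst_comp_eval fl (brl c)).
by rewrite rmorphN /= map_polyX hornerN hornerX.
Qed.

(** The right slot turns d into d + lambda; then d goes to [x] and lambda to [y]. *)
Lemma bracket_subst_compr (f : A -> polymod (polymod A)) x y a :
  semilinear (poly_eval3 k x) f ->
  semilinear (poly_eval3 k (x + y)) (fun w => polymod_subst f y (br a w)).
Proof.
move=> fl; apply: (polymod_subst_comp_eval fl (brr a)).
by rewrite rmorphD /= map_polyC map_polyX hornerD hornerC hornerX /= poly_evalX.
Qed.

(** The inner coefficient [p] passes through the right slot of the outer bracket, where d becomes d
    + [x]; in the outer coefficient [q], d stays d. *)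
Lemma bracket_nestr x y a b c p q e e' :
  br b c = p *: polymod_const e -> br a e = q *: polymod_const e' ->
  polymod_subst (fun w => polymod_subst (@polymod_const2 k A) x (br a w)) y (br b c)
  = ((map_poly (poly_eval3 k ('X%:P%:P + x)) p).[y]
     * (map_poly (poly_eval3 k 'X%:P%:P) q).[x]) *: polymod_const2 e'.
Proof.
move=> -> ae; rewrite (polymod_subst_scale_const _ _ _ (bracket_substr x a)) ae.
by rewrite (polymod_subst_scale_const _ _ _ (@polymod_const2_eval _ A)) scalerA.
Qed.

Lemma bracket_nestl x y a b c p q e e' :
  br a b = p *: polymod_const e -> br e c = q *: polymod_const e' ->
  polymod_subst (fun w => polymod_subst (@polymod_const2 k A) x (br w c)) y (br a b)
  = ((map_poly (poly_eval3 k (- x)) p).[y]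
     * (map_poly (poly_eval3 k 'X%:P%:P) q).[x]) *: polymod_const2 e'.
Proof.
move=> -> ec; rewrite (polymod_subst_scale_const _ _ _ (bracket_substl x c)) ec.
by rewrite (polymod_subst_scale_const _ _ _ (@polymod_const2_eval _ A)) scalerA.
Qed.

(* jacobil and jacobir are the two sides of lc_jacobi; bracket_flip below is the
   right-hand side of lc_skew. *)
Definition jacobil (a b c : A) : polymod (polymod A) :=
  polymod_subst (fun w => polymod_subst (@polymod_const2 k A) 'X%:P (br a w))
    'X (br b c).

Definition jacobir (a b c : A) : polymod (polymod A) :=
  polymod_subst (fun w => polymod_subst (@polymod_const2 k A) ('X%:P + 'X) (br w c))
    'X%:P (br a b)
  + polymod_subst (fun w => polymod_subst (@polymod_const2 k A) 'X (br b w))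
    'X%:P (br a c).

Lemma jacobil_semilinear1 b c :
  semilinear (poly_eval3 k (- 'X%:P)) (fun a => jacobil a b c).
Proof. by apply: polymod_subst_param => w; apply: bracket_substl. Qed.

Lemma jacobil_semilinear2 a c :
  semilinear (poly_eval3 k (- 'X)) (fun b => jacobil a b c).
Proof. exact: bracket_subst_compl (bracket_substr _ _). Qed.

Lemma jacobil_semilinear3 a b :
  semilinear (poly_eval3 k ('X%:P%:P + 'X%:P + 'X)) (jacobil a b).
Proof. exact: bracket_subst_compr (bracket_substr _ _). Qed.

Lemma jacobir_semilinear1 b c :
  semilinear (poly_eval3 k (- 'X%:P)) (fun a => jacobir a b c).
Proof.
apply: semilinear_add; first exact: bracket_subst_compl (bracket_substl _ _).
exact: bracket_subst_compl (bracket_substr _ _).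
Qed.

Lemma jacobir_semilinear2 a c :
  semilinear (poly_eval3 k (- 'X)) (fun b => jacobir a b c).
Proof.
apply: semilinear_add; last first.
  by apply: polymod_subst_param => w; apply: bracket_substl.
(* In the first term the outer bracket sends d to - (lambda + mu), and the inner one adds lambda for
   [b]. *)
have -> : - 'X = - ('X%:P + 'X) + 'X%:P :> {poly {poly {poly k}}}.
  by rewrite opprD addrAC addNr add0r.
exact: bracket_subst_compr (bracket_substl _ _).
Qed.

Lemma jacobir_semilinear3 a b :
  semilinear (poly_eval3 k ('X%:P%:P + 'X%:P + 'X)) (jacobir a b).
Proof.
apply: semilinear_add.
  (* In the first term [c] enters through the coefficient map, with d + (lambda + mu); in the
     second, the outer bracket gives d + mu and the inner one adds lambda. *)
  rewrite -addrA; apply: polymod_subst_param => w; exact: bracket_substr.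
rewrite addrAC; exact: bracket_subst_compr (bracket_substr _ _).
Qed.

Definition bracket_flip (a b : A) : polymod A :=
  - polymod_subst (@polymod_const _ A) (- 'X - 'X%:P) (br b a).

(** The right slot of [br b a] gives d + lambda, which becomes - lambda when lambda is replaced by -
    lambda - d. *)
Lemma bracket_flip_semilinearl b :
  semilinear (poly_eval2 k (- 'X)) (bracket_flip^~ b).
Proof.
apply: semilinear_opp.
apply: (polymod_subst_comp_eval (@polymod_const_eval k A) (brr b)).
rewrite rmorphD /= map_polyC map_polyX hornerD hornerC hornerX /= poly_evalX.
by rewrite addrC subrK.
Qed.

Lemma bracket_flip_semilinearr a :
  semilinear (poly_eval2 k ('X%:P + 'X)) (bracket_flip a).
Proof.
apply: semilinear_opp.
apply: (polymod_subst_comp_eval (@polymod_const_eval k A) (brl a)).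
by rewrite rmorphN /= map_polyX hornerN hornerX opprD !opprK addrC.
Qed.

End SesquilinearBracket.

(** * Reduction of the axioms to a basis *)

Section BasisCriterion.
Variables (k : comNzRingType) (K : choiceType).
Let A : lmodType {poly k} := {malg {poly k}[K]}.
Variable br : A -> A -> polymod A.
Hypothesis brl : forall b, semilinear (poly_eval2 k (- 'X)) (br^~ b).
Hypothesis brr : forall a, semilinear (poly_eval2 k ('X%:P + 'X)) (br a).

Lemma is_lie_conformal_basis :
  (forall x y, br << x >> << y >> = bracket_flip br << x >> << y >>) ->
  (forall x y z,
    jacobil br << x >> << y >> << z >> = jacobir br << x >> << y >> << z >>) ->
  is_lie_conformal br.
Proof.
move=> skew_basis jacobi_basis; split.
- by move=> c a a' b; rewrite (brl b c%:P) poly_evalC.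
- by move=> c a b b'; rewrite (brr a c%:P) poly_evalC.
- by move=> a b; rewrite (semilinearZ (brl b)) /= poly_evalX.
- by move=> a b; rewrite (semilinearZ (brr a)) /= poly_evalX.
(* Arguments are generalized one at a time, since each has its own ring map. *)
- move=> a b; change (br a b = bracket_flip br a b); move: a.
  apply: semilinear_eq_basis (brl b) (bracket_flip_semilinearl brr b) _ => x.
  move: b; apply: semilinear_eq_basis (brr _) (bracket_flip_semilinearr brl _) _.
  exact: skew_basis.
move=> a b c; change (jacobil br a b c = jacobir br a b c); move: a.
apply: semilinear_eq_basis (jacobil_semilinear1 brl b c)
  (jacobir_semilinear1 brl brr b c) _ => x.
move: b; apply: semilinear_eq_basis (jacobil_semilinear2 brl brr _ c)
  (jacobir_semilinear2 brl brr _ c) _ => y.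
move: c; apply: semilinear_eq_basis (jacobil_semilinear3 brr _ _)
  (jacobir_semilinear3 brr _ _) _.
exact: jacobi_basis.
Qed.

End BasisCriterion.

(** * The brackets of CHV on its basis *)

Section CHVBracket.
Variable k : comNzRingType.
Implicit Types x y z : (int + int)%type.

Definition chv_coef x y : {poly {poly k}} :=
  match x, y with
  | inl _, inl _ => 'X%:P + 2 * 'X
  | inl _, inr _ => 'X%:P + 'X
  | inr _, inl _ => 'X
  | inr _, inr _ => 0
  end.

(** The value [inr (i + j)] on two H's, where the coefficient is 0, makes this operation
    associative, so that all three Jacobi terms carry the same index. *)
Definition chv_index x y : (int + int)%type :=
  match x, y with
  | inl i, inl j => inl (i + j)
  | inl i, inr j | inr i, inl j | inr i, inr j => inr (i + j)
  end.

Lemma chv_indexC x y : chv_index x y = chv_index y x.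
Proof. by case: x y => i [] j /=; rewrite addrC. Qed.

Lemma chv_indexA x y z :
  chv_index x (chv_index y z) = chv_index (chv_index x y) z.
Proof. by case: x y z => i [] j [] l /=; rewrite addrA. Qed.

Lemma chv_coef_eval (S : comNzRingType) (iota : {rmorphism k -> S}) (d l : S) x y :
  (map_poly (poly_eval iota d) (chv_coef x y)).[l] =
  match x, y with
  | inl _, inl _ => d + 2 * l
  | inl _, inr _ => d + l
  | inr _, inl _ => l
  | inr _, inr _ => 0
  end.
Proof.
by case: x y => i [] j /=; rewrite ?rmorph0 ?rmorphD ?rmorphM ?rmorph_nat /=
  ?map_polyC ?map_polyX ?hornerE /= ?poly_evalX.
Qed.

Lemma chv_bracketU x y :
  chv_bracket << x >> << y >> = chv_basis_bracket k x y.
Proof. exact: sesqui_extU. Qed.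

Lemma chv_basis_bracketE x y :
  chv_basis_bracket k x y
  = chv_coef x y *: polymod_const (<< chv_index x y >> : CHV k).
Proof. by case: x y => i [] j //=; rewrite scale0r. Qed.

Let brl b : semilinear (poly_eval2 k (- 'X)) ((@chv_bracket k)^~ b) :=
  @sesqui_ext_semilinearl _ _ _ b.
Let brr a : semilinear (poly_eval2 k ('X%:P + 'X)) (@chv_bracket k a) :=
  @sesqui_ext_semilinearr _ _ _ a.

Lemma chv_flip_basis x y :
  chv_bracket << x >> << y >> = bracket_flip (@chv_bracket k) << x >> << y >>.
Proof.
rewrite /bracket_flip !chv_bracketU !chv_basis_bracketE.
rewrite (polymod_subst_scale_const _ _ _ (@polymod_const_eval _ _)) chv_indexC.
rewrite -scaleNr; congr (_ *: _).
(* For two L's: d + 2 lambda = - (d + 2 (- lambda - d)). For a mixed pair the substitution exchanges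
   d + lambda and lambda up to sign. *)
by rewrite chv_coef_eval; case: x y => i [] j /=; ring.
Qed.

Lemma chv_jacobi_basis x y z :
  jacobil (@chv_bracket k) << x >> << y >> << z >>
  = jacobir (@chv_bracket k) << x >> << y >> << z >>.
Proof.
have brU a b : chv_bracket << a >> << b >>
    = chv_coef a b *: polymod_const (<< chv_index a b >> : CHV k).
  by rewrite chv_bracketU chv_basis_bracketE.
(* The two scalars given are the variables of the outer and of the inner bracket, in this order. *)
have eL := bracket_nestr brr 'X%:P 'X (brU y z) (brU x (chv_index y z)).
have eR1 := bracket_nestl brl ('X%:P + 'X) 'X%:P (brU x y) (brU (chv_index x y) z).
have eR2 := bracket_nestr brr 'X 'X%:P (brU x z) (brU y (chv_index x z)).
apply: etrans eL _; apply: etrans (esym (congr2 +%R eR1 eR2)).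
(* With all indices in one form, only the coefficients remain to be compared. *)
rewrite [chv_index y (chv_index _ _)]chv_indexA (chv_indexC y x) chv_indexA.
rewrite -scalerDl !chv_coef_eval; congr (_ *: _).
(* For three L's: (d + lambda + 2 mu)(d + 2 lambda) = (lambda - mu)(d + 2 lambda + 2 mu) + (d + mu +
   2 lambda)(d + 2 mu). *)
by case: x y z {eR1 eR2} => i [] j [] l /=; ring.
Qed.

Lemma chv_is_lie_conformal : is_lie_conformal (@chv_bracket k).
Proof.
exact: (is_lie_conformal_basis brl brr chv_flip_basis chv_jacobi_basis).
Qed.

End CHVBracket.

Theorem proposition3p3 (R : realType) :
  is_lie_conformal (@chv_bracket R[i]) /\
  forall i j : int,
    [/\ chv_bracket (chvL R[i] i) (chvL R[i] j)
          = ('X%:P + 2 * 'X) *: polymod_const (chvL R[i] (i + j)),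
        chv_bracket (chvL R[i] i) (chvH R[i] j)
          = ('X%:P + 'X) *: polymod_const (chvH R[i] (i + j)),
        chv_bracket (chvH R[i] i) (chvL R[i] j)
          = 'X *: polymod_const (chvH R[i] (i + j))
      & chv_bracket (chvH R[i] i) (chvH R[i] j) = 0].
Proof.
split; last by move=> i j; rewrite /chvL /chvH !chv_bracketU.
exact: chv_is_lie_conformal.
Qed.
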